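(* For every $s>0$ there is a constant $C(s)\in(0,\infty)$, depending only on $s$, such that for every $A\subset\mathbb R^d$ and every $0<\delta<\infty$, $$\mathcal P^s(A)\le\mathcal M^s_\infty(A)\le\mathcal M^s_\delta(A)\le\mathcal M^s(A)\le C(s)\,\mathcal P^s(A).$$
   Context: Here $d\ge1$ and $X=\mathbb R^d$ has the Euclidean metric. $B(x,r)$ is the closed ball; each ball carries its given centre and radius. $|E|$ is the diameter of $E$, with $|\varnothing|=0$ and $|E|=\infty$ allowed; $\overline E$ is the closure. $\inf\varnothing=\infty$, and empty sums are $0$. A packing is a finite or countable pairwise disjoint family of closed balls. For $s>0$, $\delta\in(0,\infty]$, $E\subset \mathbb R^d$, $$\mathcal P^{s}_{\delta}(E):=\sup\Big\{\sum_i(2r_i)^s:\{B(x_i,r_i)\}_i\text{ is a packing},\ x_i\in E,\ 0<r_i<\infty,\ r_i\le\delta\Big\},$$ $\mathcal P^s_0(E):=\inf_{\delta>0}\mathcal P^s_\delta(E)$, and the packing measure is $$\mathcal P^s(F):=\inf\Big\{\sum_{j=1}^\infty\mathcal P^s_0(F_j):F\subseteq\bigcup_{j=1}^\infty F_j\Big\}.$$ For nonempty $E\subset\mathbb R^d$ and $0<R<\infty$ with $|E|\le R$, $$\Phi^s(E,R):=\sup\Big\{\sum_{i=1}^N(2r_i)^s: N\ge1,\ x_i\in\overline E,\ 0<r_i\le R,\ |x_i-x_j|\ge r_i+r_j\ (i\ne j)\Big\},$$ and $\Phi^s(\varnothing,R):=0$. For $0<\delta<\infty$, $$\mathcal M^s_\delta(F):=\inf\Big\{\sum_{j=1}^\infty\Phi^s(E_j,R_j):F\subseteq\bigcup_{j}E_j,\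 |E_j|\le R_j\le\delta,\ R_j>0\Big\},$$ the labelled packing measure is $\mathcal M^s(F):=\lim_{\delta\downarrow0}\mathcal M^s_\delta(F)=\sup_{0<\delta<1}\mathcal M^s_\delta(F)$, and the labelled packing content is $$\mathcal M^s_\infty(F):=\inf\Big\{\sum_j\Phi^s(E_j,R_j):F\subseteq\bigcup_jE_j,\ |E_j|\le R_j,\ 0<R_j<\infty\Big\}$$ (countable covers). *)

(* Defs.v *)
From HB Require Import structures.
From mathcomp Require Import all_boot all_order all_algebra.
From mathcomp Require Import all_classical all_reals all_analysis.
Import Order.TTheory GRing.Theory Num.Theory.
Import numFieldNormedType.Exports.

Set Implicit Arguments.
Unset Strict Implicit.
Unset Printing Implicit Defensive.

Local Open Scope classical_set_scope.
Local Open Scope ring_scope.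
Local Open Scope ereal_scope.

(* The library's norm and balls on 'rV[R]_d are those of the max norm, hence
   the explicit Euclidean metric below.  The library's topology on 'rV[R]_d
   agrees with the Euclidean one (see [closure_edistP]), so [closure] is used
   as is. *)
Definition edist (R : realType) (d : nat) (x y : 'rV[R]_d) : R :=
  Num.sqrt (\sum_(i < d) (x ord0 i - y ord0 i) ^+ 2)%R.

Definition eball (R : realType) (d : nat) (x : 'rV[R]_d) (r : R) :
  set 'rV[R]_d := [set y | (edist x y <= r)%R].

(* Adjoining 0 only affects the empty set, whose diameter is 0. *)
Definition diam (R : realType) (d : nat) (E : set 'rV[R]_d) : \bar R :=
  ereal_sup ([set 0] `|`
    [set t | exists x y, [/\ E x, E y & t = (edist x y)%:E]]).

(* The index set I ranges over all subsets of nat, so that the family is finite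
   (possibly empty) or countably infinite; disjointness is required of the
   balls as point sets. *)
Definition is_packing (R : realType) (d : nat) (I : set nat)
    (x : nat -> 'rV[R]_d) (r : nat -> R) : Prop :=
  trivIset I (fun i => eball (x i) (r i)).

Definition packing_premeasure_at (R : realType) (d : nat) (s : R)
    (delta : \bar R) (E : set 'rV[R]_d) : \bar R :=
  ereal_sup [set t | exists (I : set nat) (x : nat -> 'rV[R]_d) (r : nat -> R),
    [/\ is_packing I x r,
        forall i, I i -> [/\ E (x i), (0 < r i)%R & (r i)%:E <= delta]
      & t = \esum_(i in I) ((2 * r i) `^ s)%:E]].

Definition packing_premeasure (R : realType) (d : nat) (s : R)
    (E : set 'rV[R]_d) : \bar R :=
  ereal_inf [set packing_premeasure_at s delta E | delta in [set u | 0 < u]].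

Definition packing_measure (R : realType) (d : nat) (s : R)
    (F : set 'rV[R]_d) : \bar R :=
  ereal_inf [set t | exists E : nat -> set 'rV[R]_d,
    F `<=` \bigcup_j E j /\ t = \sum_(0 <= j <oo) packing_premeasure s (E j)].

Definition Phi (R : realType) (d : nat) (s : R) (E : set 'rV[R]_d) (r0 : R) :
    \bar R :=
  if E == set0 then 0 else
  ereal_sup [set t | exists (N : nat) (x : 'I_N -> 'rV[R]_d) (r : 'I_N -> R),
    [/\ (1 <= N)%N,
        forall i, [/\ closure E (x i), (0 < r i)%R & (r i <= r0)%R],
        forall i j, i != j -> (r i + r j <= edist (x i) (x j))%R
      & t = (\sum_(i < N) (2 * r i) `^ s)%:E]].

(* Countable covers are indexed by nat; a finite cover is padded with empty
   sets, which contribute Phi s set0 _ = 0. *)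
Definition labelled_cover (R : realType) (d : nat) (F : set 'rV[R]_d)
    (E : nat -> set 'rV[R]_d) (r : nat -> R) : Prop :=
  F `<=` \bigcup_j E j /\ forall j, (0 < r j)%R /\ diam (E j) <= (r j)%:E.

Definition labelled_premeasure (R : realType) (d : nat) (s delta : R)
    (F : set 'rV[R]_d) : \bar R :=
  ereal_inf [set t | exists (E : nat -> set 'rV[R]_d) (r : nat -> R),
    [/\ labelled_cover F E r, forall j, (r j <= delta)%R
      & t = \sum_(0 <= j <oo) Phi s (E j) (r j)]].

(* This limit is also the supremum over 0 < delta < 1, see
   [labelled_measureE]. *)
Definition labelled_measure (R : realType) (d : nat) (s : R)
    (F : set 'rV[R]_d) : \bar R :=
  lim (labelled_premeasure s delta F @[delta --> 0%R^'+]).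

Definition labelled_content (R : realType) (d : nat) (s : R)
    (F : set 'rV[R]_d) : \bar R :=
  ereal_inf [set t | exists (E : nat -> set 'rV[R]_d) (r : nat -> R),
    labelled_cover F E r /\ t = \sum_(0 <= j <oo) Phi s (E j) (r j)].

Lemma le_labelled_premeasure (R : realType) (d : nat) (s a b : R)
    (F : set 'rV[R]_d) :
  (a <= b)%R -> labelled_premeasure s b F <= labelled_premeasure s a F.
Proof.
move=> ab; apply: ereal_inf_le_tmp => t [E [r [cov ra ->]]].
by exists E, r; split=> // j; exact: le_trans (ra j) ab.
Qed.

Lemma labelled_measureE (R : realType) (d : nat) (s : R) (F : set 'rV[R]_d) :
  labelled_measure s F =
  ereal_sup [set labelled_premeasure s delta F |
             delta in [set u : R | (0 < u < 1)%R]].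
Proof.
have -> : [set u : R | (0 < u < 1)%R] = [set` `]0%R, 1%R[ ].
  by apply/seteqP; split=> u /=; rewrite in_itv.
apply/cvg_lim => //.
apply: (@nonincreasing_at_right_cvge _ (fun u => labelled_premeasure s u F)
  0%R (BLeft 1%R)) => //=; first by rewrite bnd_simp.
by move=> u v _ _; exact: le_labelled_premeasure.
Qed.

Lemma closure_edistP (R : realType) (d : nat) (E : set 'rV[R]_d)
    (x : 'rV[R]_d) :
  closure E x <->
  forall e : R, (0 < e)%R -> exists2 y, E y & (edist x y < e)%R.
Proof.
split=> [clE e e0|h U].
- pose c := (e / d.+1%:R)%R.
  have c0 : (0 < c)%R by rewrite divr_gt0.
  have [y [Ey xy]] := clE _ (nbhsx_ballx x c c0).
  exists y => //; rewrite /edist.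
  have -> : e = Num.sqrt (e ^+ 2) by rewrite sqrtr_sqr gtr0_norm.
  rewrite ltr_sqrt ?exprn_gt0//.
  apply: (@le_lt_trans _ _ (\sum_(i < d) c ^+ 2)%R).
    apply: ler_sum => i _; rewrite -real_normK ?num_real//.
    have := xy.2 ord0 i; rewrite /ball /= => /ltW ?.
    by rewrite lerXn2r// ?nnegrE ?(ltW c0).
  rewrite sumr_const card_ord -mulr_natl /c expr_div_n mulrCA.
  rewrite gtr_pMr ?exprn_gt0// ltr_pdivrMr ?exprn_gt0// mul1r.
  by rewrite -natrX ltr_nat -mulnn mulSn ltn_addr.
- move=> /nbhs_ballP[e e0 eU]; have [y Ey xy] := h _ e0.
  exists y; split=> //; apply: eU; split=> // i j; rewrite (ord1 i).
  rewrite /ball /=; apply: le_lt_trans xy.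
  rewrite -sqrtr_sqr /edist ler_wsqrtr// (bigD1 j)//= lerDl.
  by apply: sumr_ge0 => k _; rewrite sqr_ge0.
Qed.

(* Main.v *)
(** Disjoint balls have their centres further apart than the sum of their radii,
    so the packing premeasure of [E] at scale [r0] is at most [Phi s E r0], and
    conversely [Phi s E r0] is at most [2 `^ s] times the supremum of the sums
    [\sum_i (2 * r_i) `^ s] over finite packings of [E] with radii at most [r0].

    For the last inequality, let [g r] be that supremum for [F `&` B(x, r)] and
    radii at most [2 * r].  Since [g r >= (4 * r) `^ s], the function [g] cannot
    drop by more than [2 * 6 `^ s] at every step [r -> r / 6] unless it is
    infinite, so each [x] in [F] has arbitrarily small radii [r] with
    [g (6 * r) <= 2 * 6 `^ s * g r].  A greedy selection, largest radius first,
    yields points at mutual distances greater than [3 * r_i + 3 * r_j]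
    such that the balls [B(x_i, 6 * r_i)] cover [F].
    Packings of the sets [F `&` B(x_i, r_i)] can be put together into a packing
    of [F], so the sum of the [g r_i] is at most the packing premeasure of [F].
    No doubling property of the space is used: the constant is independent of
    the dimension. *)
From mathcomp Require Import all_boot all_order all_algebra.
From mathcomp Require Import all_classical all_reals all_analysis.
From mathcomp Require Import lra ring.
(* Defs comes last because the analysis library has another [edist]. *)
Require Import Defs.
Import Order.TTheory GRing.Theory Num.Theory.
Import numFieldNormedType.Exports.

Set Implicit Arguments.
Unset Strict Implicit.
Unset Printing Implicit Defensive.

Local Open Scope classical_set_scope.
Local Open Scope ring_scope.
Local Open Scope ereal_scope.

(** * Euclidean distance and disjointness of balls *)

Section Edist.
Context {R : realType} {d : nat}.
Implicit Types (x y z : 'rV[R]_d) (r t : R).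
Local Open Scope ring_scope.

Lemma edist_ge0 x y : 0 <= edist x y.
Proof. exact: sqrtr_ge0. Qed.

Lemma edistxx x : edist x x = 0.
Proof. by rewrite /edist big1 ?sqrtr0// => i _; rewrite subrr expr0n. Qed.

Lemma edistC x y : edist x y = edist y x.
Proof.
by rewrite /edist; congr Num.sqrt; apply: eq_bigr => i _; rewrite -sqrrN opprB.
Qed.

Lemma edist_sqr x y : edist x y ^+ 2 = \sum_(i < d) (x ord0 i - y ord0 i) ^+ 2.
Proof. by rewrite sqr_sqrtr// sumr_ge0// => i _; rewrite sqr_ge0. Qed.

Lemma edist_eq0 x y : edist x y = 0 -> x = y.
Proof.
move=> xy0; apply/rowP => i; apply/eqP; rewrite -subr_eq0 -sqrf_eq0.
have /eqP := edist_sqr x y; rewrite xy0 expr0n/= eq_sym psumr_eq0.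
  by move=> /allP /(_ i); rewrite mem_index_enum => /(_ isT).
by move=> j _; rewrite sqr_ge0.
Qed.

Lemma edist_triangle y x z : edist x z <= edist x y + edist y z.
Proof.
have [/edist_eq0 ->|aN0] := eqVneq (edist x y) 0.
  by rewrite lerDr edist_ge0.
have [/edist_eq0 ->|bN0] := eqVneq (edist y z) 0.
  by rewrite lerDl edist_ge0.
have := edist_ge0 x y; have := edist_ge0 y z.
move: aN0 bN0; set a := edist x y; set b := edist y z => aN0 bN0 b0 a0.
have {}a0 : 0 < a by rewrite lt_neqAle eq_sym aN0.
have {}b0 : 0 < b by rewrite lt_neqAle eq_sym bN0.
rewrite -ler_sqr ?nnegrE ?edist_ge0 ?addr_ge0 ?(ltW a0) ?(ltW b0)//.
(* [(u + v)^2 <= (1 + b/a) u^2 + (1 + a/b) v^2] in each coordinate. *)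
apply: (@le_trans _ _ ((1 + b / a) * a ^+ 2 + (1 + a / b) * b ^+ 2));
  last first.
  by rewrite le_eqVlt; apply/orP; left; apply/eqP; field; rewrite aN0 bN0.
rewrite !edist_sqr !mulr_sumr -big_split/=; apply: ler_sum => i _.
set u := x ord0 i - y ord0 i; set v := y ord0 i - z ord0 i.
have -> : x ord0 i - z ord0 i = u + v by rewrite /u /v; ring.
rewrite -subr_ge0.
have -> : (1 + b / a) * u ^+ 2 + (1 + a / b) * v ^+ 2 - (u + v) ^+ 2 =
  (b * u - a * v) ^+ 2 / (a * b) by field; rewrite aN0 bN0.
by rewrite divr_ge0 ?sqr_ge0// mulr_ge0// ltW.
Qed.

Lemma edist_affine x y t : 0 <= t -> edist x (x + t *: (y - x)) = t * edist x y.
Proof.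
move=> t0; rewrite /edist -[in RHS](ger0_norm t0) -sqrtr_sqr -sqrtrM ?sqr_ge0//.
congr Num.sqrt; rewrite mulr_sumr; apply: eq_bigr => i _.
by rewrite !mxE; ring.
Qed.

(** Disjointness bounds the distance of the centres because the segment between them lies in the
    space; in a general metric space this direction fails. *)
Lemma disjoint_eballP x y r t : 0 < r -> 0 < t ->
  eball x r `&` eball y t = set0 <-> r + t < edist x y.
Proof.
move=> r0 t0; split=> [xy0|xy]; last first.
  apply/seteqP; split=> // z [/= xz yz].
  have := edist_triangle z x y; rewrite (edistC z).
  by move: xz yz; rewrite /eball/= => ? ? ?; lra.
rewrite ltNge; apply/negP => xy.
have rt0 : 0 < r + t by rewrite addr_gt0.
(* This point divides the segment from [x] to [y] in the ratio [r] to [t], so it lies in both balls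
   when [edist x y <= r + t]. *)
have : set0 (x + (r / (r + t)) *: (y - x)); last by [].
rewrite -xy0; split; rewrite /eball/=.
  rewrite edist_affine; last by rewrite divr_ge0 ?ltW.
  by rewrite mulrAC ler_pdivrMr// ler_pM2l.
have -> : x + (r / (r + t)) *: (y - x) = y + (t / (r + t)) *: (x - y).
  by apply/rowP => i; rewrite !mxE; field; exact: lt0r_neq0.
rewrite edist_affine; last by rewrite divr_ge0 ?ltW.
by rewrite mulrAC ler_pdivrMr// ler_pM2l// edistC.
Qed.

End Edist.

(** * Finite packings and their comparison with [Phi] *)

Definition separated_packing (R : realType) (d : nat) (delta : R)
    (E : set 'rV[R]_d) (l : seq ('rV[R]_d * R)) : Prop :=
  pairwise (fun a b => a.2 + b.2 < edist a.1 b.1)%R l /\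
  forall a, a \in l -> [/\ E a.1, (0 < a.2)%R & (a.2 <= delta)%R].

Definition packing_sum (R : realType) (d : nat) (s : R)
    (l : seq ('rV[R]_d * R)) : R :=
  (\sum_(a <- l) (2 * a.2) `^ s)%R.

(** By [disjoint_eballP] the lists are the finite packings; joining two packings becomes a
    concatenation. *)
Definition finite_premeasure (R : realType) (d : nat) (s delta : R)
    (E : set 'rV[R]_d) : \bar R :=
  ereal_sup [set (packing_sum s l)%:E | l in separated_packing delta E].

Section FinitePremeasure.
Context {R : realType} {d : nat} (s : R).
Implicit Types (E F : set 'rV[R]_d) (delta : R).

Lemma packing_sum_ge0 (l : seq ('rV[R]_d * R)) : (0 <= packing_sum s l)%R.
Proof. by apply: sumr_ge0 => a _; exact: powR_ge0. Qed.

Lemma packing_sum_cat (l1 l2 : seq ('rV[R]_d * R)) :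
  packing_sum s (l1 ++ l2) = (packing_sum s l1 + packing_sum s l2)%R.
Proof. exact: big_cat. Qed.

Lemma finite_premeasure_ge0 delta E : 0 <= finite_premeasure s delta E.
Proof.
by apply: ereal_sup_ubound; exists [::]; rewrite /packing_sum ?big_nil.
Qed.

Lemma le_finite_premeasure delta1 delta2 E F : E `<=` F ->
  (delta1 <= delta2)%R ->
  finite_premeasure s delta1 E <= finite_premeasure s delta2 F.
Proof.
move=> EF d12; apply: ereal_sup_le => _ [l [sep lE] <-]; exists l => //.
split=> // a /lE[Ea a0 ad]; split=> //; first exact: EF.
exact: le_trans ad d12.
Qed.

Lemma finite_premeasure_ge_ball delta E x : E x -> (0 < delta)%R ->
  ((2 * delta) `^ s)%:E <= finite_premeasure s delta E.
Proof.
move=> Ex d0; apply: ereal_sup_ubound; exists [:: (x, delta)].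
  by split=> // a; rewrite inE => /eqP ->.
by rewrite /packing_sum big_seq1.
Qed.

Lemma finite_premeasure_le_packing delta E :
  finite_premeasure s delta E <= packing_premeasure_at s delta%:E E.
Proof.
apply: ge_ereal_sup => _ [l [sep lE] <-]; apply: ereal_sup_ubound.
pose c0 : 'rV[R]_d * R := (0, 0)%R; pose c := nth c0 l.
have lP i : `I_(size l) i ->
    [/\ E (c i).1, (0 < (c i).2)%R & ((c i).2 <= delta)%R].
  by move=> il; apply: lE; exact: mem_nth.
exists `I_(size l), (fun i => (c i).1), (fun i => (c i).2); split.
- apply/trivIsetP => i j il jl.
  wlog ij : i j il jl / (i < j)%N => [hw|] ij'.
    move: (ij'); rewrite neq_ltn => /orP[/hw->//|/hw h].
    by rewrite setIC h// eq_sym.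
  have [_ ci0 _] := lP i il; have [_ cj0 _] := lP j jl.
  apply/disjoint_eballP => //.
  by move/(pairwiseP c0): sep; apply.
- by move=> i /lP[].
- rewrite esum_fset//; last by move=> i _; rewrite lee_fin powR_ge0.
  rewrite -fsbig_ord sumEFin /packing_sum (big_nth c0) big_mkord.
  by [].
Qed.

Lemma Phi_ge0 E (r0 : R) : (0 < r0)%R -> 0 <= Phi s E r0.
Proof.
move=> r00; rewrite /Phi; case: ifPn => // /set0P[x Ex].
apply: (@le_trans _ _ (\sum_(i < 1) (2 * r0) `^ s)%R%:E).
  by rewrite lee_fin sumr_ge0// => i _; exact: powR_ge0.
apply: ereal_sup_ubound; exists 1%N, (fun=> x), (fun=> r0); split=> // [i|i j].
  by split=> //; exact: subset_closure.
by rewrite (ord1 i) (ord1 j) eqxx.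
Qed.

(** [\esum] is a supremum over finite subfamilies, and each nonempty one is admissible for [Phi] by
    [disjoint_eballP]. *)
Lemma packing_le_Phi delta E : (0 < delta)%R ->
  packing_premeasure_at s delta%:E E <= Phi s E delta.
Proof.
move=> d0; apply: ge_ereal_sup => _ [I [x [r [tI Ixr ->]]]].
apply: ge_ereal_sup => _ [X [finX XI] <-].
have [->|XN0] := eqVneq X set0; first by rewrite fsbig_set0 Phi_ge0.
rewrite /Phi ifF; last first.
  have /set0P[i /XI /Ixr[Ei _ _]] := XN0.
  by apply/negbTE/set0P; exists (x i).
rewrite fsbig_finite//= sumEFin.
set l : seq nat := finmap.enum_fset (fset_set X).
have lI k : (k < size l)%N -> I (nth 0%N l k).
  by move=> kl; apply/XI/set_mem; rewrite -in_fset_set// mem_nth.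
apply: ereal_sup_ubound.
exists (size l), (fun i => x (nth 0%N l i)), (fun i => r (nth 0%N l i)); split.
- have /set0P[i Xi] := XN0.
  have : i \in l by rewrite in_fset_set// mem_set.
  by case: (l).
- move=> i; have [Ei ri rd] := Ixr _ (lI i (ltn_ord i)).
  by split=> //; exact: subset_closure.
- move=> i j ij; have [_ ri _] := Ixr _ (lI i (ltn_ord i)).
  have [_ rj _] := Ixr _ (lI j (ltn_ord j)).
  apply/ltW/disjoint_eballP => //.
  move/trivIsetP : tI; apply; [exact: lI|exact: lI|].
  by rewrite nth_uniq// finmap.fset_uniq.
- by rewrite (big_nth 0%N) big_mkord.
Qed.

(* Halving the radii leaves room to move the centres from the closure of [E]
   into [E] and to make the separation strict, at the cost of [2 `^ s]. *)
Lemma Phi_le_finite_premeasure delta E :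
  Phi s E delta <= (2 `^ s)%:E * finite_premeasure s delta E.
Proof.
rewrite /Phi; case: ifPn => _.
  by rewrite mule_ge0 ?finite_premeasure_ge0// lee_fin powR_ge0.
apply: ge_ereal_sup => _ [N [x [r [_ clE sep ->]]]].
have /choice[y yP] i : exists y, E y /\ (edist (x i) y < r i / 2)%R.
  have [/closure_edistP cl r0 _] := clE i.
  by have [y Ey xy] := cl (r i / 2)%R (divr_gt0 r0 (ltr0Sn _ 1)); exists y.
have -> : (\sum_(i < N) (2 * r i) `^ s)%R =
    (2 `^ s * packing_sum s [seq (y i, r i / 2) | i <- enum 'I_N])%R.
  rewrite /packing_sum big_map big_enum mulr_sumr; apply: eq_bigr => i _ /=.
  have [_ r0 _] := clE i.
  by rewrite -powRM ?mulr_ge0 ?divr_ge0 ?(ltW r0)//; congr powR; field.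
rewrite EFinM lee_pmul2l ?lte_fin ?powR_gt0//.
apply: ereal_sup_ubound; eexists; last reflexivity; split.
  rewrite pairwise_map.
  apply/(@sub_pairwise _ (fun i j => i != j)); last first.
    by rewrite -uniq_pairwise enum_uniq.
  move=> i j ij /=; have := sep i j ij.
  have [_ xi] := yP i; have [_ xj] := yP j.
  have := edist_triangle (y i) (x i) (x j).
  have := edist_triangle (y j) (y i) (x j).
  by rewrite (edistC (y j)); move: xi xj; lra.
move=> a /mapP[i _ ->] /=; have [_ r0 rd] := clE i; have [Ey _] := yP i.
by split=> //; lra.
Qed.

(* The induction carries a further packing [l] away from the [E j]. *)
Lemma finite_premeasure_superadditive (n : nat) (E : nat -> set 'rV[R]_d)
    (rho : nat -> R) delta F :
  (forall i, (i < n)%N -> E i `<=` F /\ (rho i <= delta)%R) ->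
  (forall i j, (i < j < n)%N -> forall a b, E i a -> E j b ->
     (rho i + rho j < edist a b)%R) ->
  \sum_(i < n) finite_premeasure s (rho i) (E i) <= finite_premeasure s delta F.
Proof.
move=> EF sepE.
suff H m l : (m <= n)%N -> separated_packing delta F l ->
    (forall a i, a \in l -> (i < m)%N -> forall b, E i b ->
      (a.2 + rho i < edist a.1 b)%R) ->
    (packing_sum s l)%:E + \sum_(i < m) finite_premeasure s (rho i) (E i) <=
    finite_premeasure s delta F.
  have := H n [::] (leqnn n).
  by rewrite /packing_sum big_nil add0e; apply.
elim: m l => [|m IH] l mn lF lE.
  by rewrite big_ord0 adde0; apply: ereal_sup_ubound; exists l.
(* With [l] unchanged, the induction hypothesis makes this sum finite once the right side is.
   Subtraction then reduces the last supremum to a single packing [l'], which is absorbed into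
   [l]. *)
have /andP[c0 cV] : 0 <= (packing_sum s l)%:E +
    \sum_(i < m) finite_premeasure s (rho i) (E i) <=
    finite_premeasure s delta F.
  rewrite adde_ge0 ?lee_fin ?packing_sum_ge0//=; last first.
    by apply: sume_ge0 => i _; exact: finite_premeasure_ge0.
  apply: IH => //; first exact: ltnW.
  by move=> a i al im; apply: lE => //; exact: ltnW.
have [->|Vfin] := eqVneq (finite_premeasure s delta F) +oo.
  by rewrite leey.
have Vlt : finite_premeasure s delta F < +oo by rewrite ltey.
have cfin : (packing_sum s l)%:E +
    \sum_(i < m) finite_premeasure s (rho i) (E i) \is a fin_num.
  by rewrite ge0_fin_numE//; exact: le_lt_trans Vlt.
rewrite big_ord_recr/= addeA -leeBrDl//.
apply: ge_ereal_sup => _ [l' [sep' l'E] <-]; rewrite leeBrDl//.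
have [EmF dm] := EF m mn.
rewrite addeAC -EFinD -packing_sum_cat; apply: IH; first exact: ltnW.
- split.
    rewrite pairwise_cat lF.1 sep' !andbT.
    apply/allrelP => a b al /l'E[Eb b0 brho].
    apply: le_lt_trans (lE a m al (ltnSn m) _ Eb).
    by rewrite lerD2l.
  move=> a; rewrite mem_cat => /orP[/lF.2//|/l'E[Ea a0 ad]].
  by split=> //; [exact: EmF|exact: le_trans ad dm].
- move=> a i; rewrite mem_cat => /orP[al|/l'E[Ea a0 ad]] im b Eb.
    by apply: lE al _ _ Eb; exact: ltnW.
  rewrite edistC addrC; apply: le_lt_trans (sepE i m _ b a.1 Eb Ea).
    by rewrite lerD2l.
  by rewrite im.
Qed.

End FinitePremeasure.

(** * Greedy selection *)

(** Each step takes an element of least [k] among those in conflict with no earlier choice; [None]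
    means that none is left. If [y] is excluded at some step, it was a candidate there, so the
    choice has no larger [k]; otherwise [y] stays a candidate forever and the selection never
    ends. *)
Lemma greedy_selection (T : Type) (F : set T) (k : T -> nat)
    (conflict : T -> T -> Prop) :
  exists u : nat -> option T,
  [/\ forall i x, u i = Some x -> F x,
      forall i j x y, (i < j)%N -> u i = Some x -> u j = Some y ->
        ~ conflict x y
    & forall y, F y ->
        (exists i x, [/\ u i = Some x, conflict x y & (k x <= k y)%N]) \/
        (forall i, exists2 x, u i = Some x & (k x <= k y)%N)].
Proof.
have /choice[pick pickP] (S : set T) : exists o : option T,
    if o is Some x then S x /\ forall y, S y -> (k x <= k y)%N else S = set0.
  have [->|/set0P[x0 Sx0]] := eqVneq S set0; first by exists None.
  pose P n := `[< exists2 x, S x & k x = n >].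
  have exP : exists n, P n by exists (k x0); apply/asboolP; exists x0.
  case: (ex_minnP exP) => n /asboolP[x Sx xn] nmin; exists (Some x).
  by split=> // y Sy; rewrite xn; apply: nmin; apply/asboolP; exists y.
pose left (C : set T) := [set y | F y /\ forall x, C x -> ~ conflict x y].
pose chosen n := iter n (fun C => C `|` [set x | pick (left C) = Some x]) set0.
pose u n := pick (left (chosen n)).
have uP i x : u i = Some x ->
    left (chosen i) x /\ forall y, left (chosen i) y -> (k x <= k y)%N.
  by move=> ui; have := pickP (left (chosen i)); rewrite -/(u i) ui.
have chosenS i j x : (i < j)%N -> u i = Some x -> chosen j x.
  elim: j => // j IH; rewrite ltnS leq_eqVlt => /predU1P[->|ij] ui.
    by right.
  by left; exact: IH.
exists u; split.
- by move=> i x /uP[[]].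
- by move=> i j x y ij ui /uP[[_ +] _]; apply; exact: chosenS ui.
- move=> y Fy; apply: contrapT => /not_orP[not_hit]; apply.
  suff leftP n : left (chosen n) y.
    move=> i; have := pickP (left (chosen i)); rewrite -/(u i).
    case: (u i) => [x [_ /(_ y (leftP i))]|e]; first by exists x.
    by have := leftP i; rewrite e.
  elim: n => [|n [_ IH]]; first by split.
  split=> // x [/IH//|/= un] xy; apply: not_hit; exists n, x; split=> //.
  by apply: (uP _ _ un).2; split.
Qed.

Lemma archimedean_bound (R : realType) (c V : R) : (0 < c)%R ->
  ~ (forall n : nat, n%:R * c <= V)%R.
Proof.
move=> c0 /(_ (Num.bound `|(V / c)%R|%R)); rewrite -ler_pdivlMr// leNgt.
by rewrite (le_lt_trans (ler_norm _))// archi_boundP.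
Qed.

(** * Doubling scales and the covering argument *)

Section Cover.
Context {R : realType} {d : nat} (s : R).
Context (s_gt0 : (0 < s)%R).
Implicit Types (E F : set 'rV[R]_d) (x y : 'rV[R]_d) (delta : R).

(** Starting at [delta / 2] keeps the radius bound [2 * r] within [delta]; 6 is the enlargement
    factor of the covering balls. *)
Definition scale delta (k : nat) : R := (delta / 2 / 6 ^+ k)%R.

Lemma scale_gt0 delta k : (0 < delta)%R -> (0 < scale delta k)%R.
Proof. by move=> d0; rewrite /scale !divr_gt0 ?exprn_gt0. Qed.

Lemma scaleS delta k : scale delta k = (6 * scale delta k.+1)%R.
Proof.
rewrite /scale exprS; field; rewrite expf_neq0 ?pnatr_eq0//.
Qed.

Lemma scale_le delta j k : (0 < delta)%R -> (j <= k)%N ->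
  (scale delta k <= scale delta j)%R.
Proof.
move=> d0 jk; rewrite /scale ler_wpM2l ?divr_ge0 ?(ltW d0)//.
by rewrite lef_pV2 ?posrE ?exprn_gt0// ler_weXn2l// ler1n.
Qed.

(** The radius bound [2 * r] also bounds the diameter of the ball, so it can serve as its label in a
    cover. *)
Definition local_premeasure F (r : R) x : \bar R :=
  finite_premeasure s (2 * r) (F `&` eball x r).

Lemma local_premeasure_ge F x (r : R) : F x -> (0 < r)%R ->
  ((4 * r) `^ s)%:E <= local_premeasure F r x.
Proof.
move=> Fx r0; rewrite (_ : 4 * r = 2 * (2 * r))%R; last by ring.
apply: (@finite_premeasure_ge_ball _ _ _ _ _ x); last by rewrite mulr_gt0.
by split=> //; rewrite /eball/= edistxx ltW.
Qed.

(* If the local premeasure dropped by more than the factor [2 * 6 `^ s] at each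
   scale, it would eventually be below the contribution [(4 r) `^ s] of the
   single ball centred at [x]. *)
Lemma exists_doubling_scale F x delta : F x -> (0 < delta)%R ->
  finite_premeasure s delta F < +oo ->
  exists k, local_premeasure F (scale delta k) x <=
    (2 * 6 `^ s)%:E * local_premeasure F (scale delta k.+1) x.
Proof.
move=> Fx d0 Vfin; apply: contrapT => /forallNP nodoubling.
pose g k := local_premeasure F (scale delta k) x.
pose c := ((4 * scale delta 0) `^ s)%R.
(* Each failed step gains 2 times 6^s. The factor 6^s makes up for the change of scale; the
   remaining powers of 2 exceed every bound. *)
have H n k : (2 ^+ n * (4 * scale delta k) `^ s)%:E <= g k.
  elim: n k => [|n IH] k.
    by rewrite expr0 mul1r local_premeasure_ge// scale_gt0.
  have /negP := nodoubling k; rewrite -ltNge => /ltW; apply: le_trans.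
  apply: le_trans (lee_wpmul2l _ (IH k.+1)); last first.
    by rewrite lee_fin mulr_ge0 ?powR_ge0.
  have -> : (4 * scale delta k = 6 * (4 * scale delta k.+1))%R.
    by rewrite [LHS]mulrC scaleS; ring.
  rewrite -EFinM lee_fin exprS (@powRM _ 6)//; last first.
    by rewrite mulr_ge0// ltW// scale_gt0.
  by rewrite le_eqVlt; apply/orP; left; apply/eqP; ring.
have c0 : (0 < c)%R by rewrite powR_gt0// mulr_gt0// scale_gt0.
have Vf : finite_premeasure s delta F \is a fin_num.
  by rewrite ge0_fin_numE// finite_premeasure_ge0.
apply: (@archimedean_bound _ c (fine (finite_premeasure s delta F)) c0) => n.
rewrite -lee_fin fineK//.
apply: (@le_trans _ _ (g 0%N)).
  apply: le_trans (H n 0%N); rewrite lee_fin ler_pM2r//.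
  by rewrite -natrX ler_nat ltnW// ltn_expl.
apply: le_finite_premeasure; first by move=> y [].
by rewrite /scale expr0 divr1; lra.
Qed.

Lemma labelled_le_finite_premeasure F delta : (0 < delta)%R ->
  labelled_premeasure s delta F <=
  (2 `^ s * (2 * 6 `^ s))%:E * finite_premeasure s delta F.
Proof.
(* 2^s pays for passing from [Phi] to packings, 2 times 6^s for shrinking the radius [6 * r] to
   [r]. *)
move=> d0; set K := (2 `^ s * (2 * 6 `^ s))%R.
have K0 : (0 < K)%R by rewrite !mulr_gt0 ?powR_gt0.
have [->|Vfin] := eqVneq (finite_premeasure s delta F) +oo.
  by rewrite gt0_muley ?leey.
have Vlt : finite_premeasure s delta F < +oo by rewrite ltey.
have Vf : finite_premeasure s delta F \is a fin_num.
  by rewrite ge0_fin_numE// finite_premeasure_ge0.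
have /choice[k kP] x : exists k, F x ->
    local_premeasure F (scale delta k) x <=
    (2 * 6 `^ s)%:E * local_premeasure F (scale delta k.+1) x.
  have [Fx|nFx] := pselect (F x); last by exists 0%N.
  by have [k kP] := exists_doubling_scale Fx d0 Vlt; exists k.
(* The successor makes [6 * r x] the scale of index [k x], so [kP] compares the radii [6 * r x] and
   [r x]. *)
pose r x := scale delta (k x).+1.
have r0 x : (0 < r x)%R by exact: scale_gt0.
have rd x : (12 * r x <= delta)%R.
  have := scale_le d0 (leq0n (k x)); rewrite scaleS -/(r x).
  by rewrite /scale expr0 divr1; lra.
(* Least [k] is largest radius. Without conflict, points of the two balls of radii [r x] and [r y]
   are more than [2 * r x + 2 * r y] apart, as superadditivity requires; a conflict with
   [r y <= r x] puts [y] into [eball x (6 * r x)]. *)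
have [u [uF uC u_cover]] := @greedy_selection _ F k
  (fun x y => edist x y <= 3 * r x + 3 * r y)%R.
(* Steps without a choice get empty sets; the default [delta] is a positive label meeting the
   bound. *)
pose E i := if u i is Some x then F `&` eball x (r x) else set0.
pose rho i := if u i is Some x then (2 * r x)%R else delta.
pose D i := if u i is Some x then F `&` eball x (6 * r x) else set0.
pose lab i := if u i is Some x then (12 * r x)%R else delta.
have sumE n : \sum_(i < n) finite_premeasure s (rho i) (E i) <=
    finite_premeasure s delta F.
  apply: finite_premeasure_superadditive.
    move=> i _; rewrite /E /rho; case: (u i) => [x|]; last by split.
    split; first by move=> ? [].
    by have := rd x; have := r0 x; lra.
  move=> i j /andP[ij _] a b; rewrite /E /rho.
  case ui : (u i) => [x|//]; case uj : (u j) => [y|//] [_ xa] [_ yb].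
  have /negP := uC _ _ _ _ ij ui uj; rewrite -ltNge.
  have := edist_triangle a x y; have := edist_triangle b a y.
  by move: xa yb; rewrite /eball/= (edistC b y); lra.
apply: (@le_trans _ _ (\sum_(0 <= j <oo) Phi s (D j) (lab j))).
  apply: ereal_inf_lbound; exists D, lab; split=> //; last first.
    by move=> j; rewrite /lab; case: (u j).
  split=> [y Fy|j].
    have [[i [x [ui xy kxy]]]|all_i] := u_cover y Fy.
      exists i => //; rewrite /D ui; split=> //; rewrite /eball/=.
      have := scale_le d0 (kxy : (k x).+1 <= (k y).+1)%N.
      by rewrite -/(r _) -/(r _); lra.
    (* An endless selection with radii at least [r y] would add at least [(4 * r y)] to the power
       [s] at every step, against [sumE]. *)
    exfalso; apply: (@archimedean_bound _ ((4 * r y) `^ s)%R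
      (fine (finite_premeasure s delta F))).
      by rewrite powR_gt0// mulr_gt0.
    move=> n; rewrite -lee_fin fineK//; apply: le_trans (sumE n).
    rewrite mulr_natl -[n in (_ *+ n)%R]card_ord -sumr_const -sumEFin.
    apply: lee_sum => i _; have [x ui kxy] := all_i i.
    rewrite /E /rho ui.
    apply: le_trans (local_premeasure_ge (uF _ _ ui) (r0 x)).
    have r4 z : (0 <= 4 * r z)%R by rewrite mulr_ge0 ?(ltW (r0 z)).
    rewrite lee_fin ge0_ler_powR ?nnegrE ?r4 ?(ltW s_gt0)//.
    by rewrite ler_pM2l//; exact: scale_le.
  rewrite /D /lab; case: (u j) => [x|]; split=> //; first by rewrite mulr_gt0.
    apply: ge_ereal_sup => _ [->|[a [b [[_ xa] [_ xb] ->]]]].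
      by rewrite lee_fin mulr_ge0// ltW.
    rewrite lee_fin; have := edist_triangle x a b; rewrite (edistC a x).
    by move: xa xb; rewrite /eball/=; lra.
  by apply: ge_ereal_sup => _ [->|[a [b [[]]]]]; rewrite lee_fin ltW.
have E0 i : 0 <= finite_premeasure s (rho i) (E i).
  exact: finite_premeasure_ge0.
apply: (@le_trans _ _
  (\sum_(0 <= j <oo) K%:E * finite_premeasure s (rho j) (E j))).
  apply: lee_nneseries => [i _ _|i _].
    by apply: Phi_ge0; rewrite /lab; case: (u i) => // x; rewrite mulr_gt0.
  rewrite /D /lab /E /rho; case ui : (u i) => [x|]; last first.
    by rewrite /Phi eqxx mule_ge0 ?finite_premeasure_ge0// lee_fin ltW.
  apply: le_trans (Phi_le_finite_premeasure _ _ _) _.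
  rewrite /K EFinM -muleA lee_pmul2l ?lte_fin ?powR_gt0//.
  have := kP x (uF _ _ ui); rewrite /local_premeasure scaleS -/(r x).
  by rewrite mulrA (_ : (2 * 6)%R = 12%R)//; ring.
rewrite nneseriesZl// lee_pmul2l//; apply: lime_le.
  by apply: is_cvg_nneseries.
by apply: nearW => n; rewrite big_mkord.
Qed.

End Cover.

(** * Countable subadditivity and the first three inequalities *)

Lemma nneseries_pairing (R : realType) (a : nat -> nat -> \bar R)
    (e : nat -> nat * nat) : (forall i j, 0 <= a i j) -> bijective e ->
  \sum_(i <oo) \sum_(j <oo) a i j = \sum_(n <oo) a (e n).1 (e n).2.
Proof.
move=> a0 bij_e; rewrite [LHS]nneseries_esumT; last first.
  by move=> i; apply: nneseries_ge0.
under eq_esum do rewrite nneseries_esumT//.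
rewrite esum_esum// [RHS]nneseries_esumT//.
rewrite (@reindex_esum _ _ _ setT _ e (fun k => a k.1 k.2))//.
rewrite (_ : _ `*`` _ = setT) ?setTT_bijective//.
by apply/seteqP; split.
Qed.

Section LabelledMeasure.
Context {R : realType} {d : nat} (s : R).
Implicit Types (A F : set 'rV[R]_d) (delta : R).

Lemma labelled_premeasure_ge0 delta F : 0 <= labelled_premeasure s delta F.
Proof.
apply: le_ereal_inf_tmp => _ [E [r [[_ rE] _ ->]]].
by apply: nneseries_ge0 => j _ _; apply: Phi_ge0; have [] := rE j.
Qed.

(** Unless some term is infinite, near-optimal covers of the [F j], with errors summing to [e],
    merge into one cover along a bijection of [nat] with [nat * nat]. *)
Lemma labelled_premeasure_sigma_subadditive delta A (F : nat -> set 'rV[R]_d) :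
  A `<=` \bigcup_j F j ->
  labelled_premeasure s delta A <=
  \sum_(j <oo) labelled_premeasure s delta (F j).
Proof.
move=> AF; have [[j Fj]|/forallNP Ffin] :=
    pselect (exists j, labelled_premeasure s delta (F j) = +oo).
  rewrite (nneseries_pinfty _ _ Fj) ?leey// => i _.
  exact: labelled_premeasure_ge0.
apply/lee_addgt0Pr => e e0.
apply: le_trans (epsilon_trick _ _ (ltW e0)); last first.
  by move=> j; exact: labelled_premeasure_ge0.
have /choice[G GP] j : exists Er : (nat -> set 'rV[R]_d) * (nat -> R),
    [/\ labelled_cover (F j) Er.1 Er.2, forall i, (Er.2 i <= delta)%R
      & \sum_(i <oo) Phi s (Er.1 i) (Er.2 i) <=
        labelled_premeasure s delta (F j) + (e / (2 ^ j.+1)%:R)%:E].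
  have ej0 : (0 < e / (2 ^ j.+1)%:R :> R)%R.
    by rewrite divr_gt0// ltr0n expn_gt0.
  have Fj : labelled_premeasure s delta (F j) \is a fin_num.
    by rewrite ge0_fin_numE ?labelled_premeasure_ge0// ltey; exact/eqP/Ffin.
  have [_ [E [r [cov rd ->]]] /ltW sumE] := lb_ereal_inf_adherent ej0 Fj.
  by exists (E, r).
have Phi0 j i : 0 <= Phi s ((G j).1 i) ((G j).2 i).
  by have [[_ /(_ i)[r0 _]] _ _] := GP j; exact: Phi_ge0.
have /card_esym/ppcard_eqP[f] := card_nat2.
have bij_f : bijective f by exact: bijTT.
apply: (@le_trans _ _
  (\sum_(j <oo) \sum_(i <oo) Phi s ((G j).1 i) ((G j).2 i))).
  rewrite (nneseries_pairing Phi0 bij_f); apply: ereal_inf_lbound.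
  exists (fun n => (G (f n).1).1 (f n).2), (fun n => (G (f n).1).2 (f n).2).
  split=> //; last by move=> n; have [_ + _] := GP (f n).1; apply.
  split=> [x /AF[j _ Fjx]|n]; last by have [[_ +] _ _] := GP (f n).1; apply.
  have [[/(_ x Fjx)[i _ Gx] _] _ _] := GP j.
  have [g _ gK] := bij_f.
  by exists (g (j, i)) => //; rewrite gK.
apply: lee_nneseries => [j _ _|j _]; first by apply: nneseries_ge0.
by have [] := GP j.
Qed.

Lemma labelled_content_le delta A :
  labelled_content s A <= labelled_premeasure s delta A.
Proof.
by apply: ereal_inf_le_tmp => _ [E [r [cov _ ->]]]; exists E, r.
Qed.

Lemma labelled_premeasure_le_measure delta A : (0 < delta)%R ->
  labelled_premeasure s delta A <= labelled_measure s A.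
Proof.
move=> d0; rewrite labelled_measureE.
(* The minimum with 1/2 brings the scale into the range of the supremum. *)
pose u := Num.min delta (2^-1)%R.
apply: (@le_trans _ _ (labelled_premeasure s u A)).
  by apply: le_labelled_premeasure; rewrite /u ge_min lexx.
apply: ereal_sup_ubound; exists u => //=.
by rewrite /u lt_min d0 gt_min /= invr_gt0 ltr0n invf_lt1// ltr1n orbT.
Qed.

Lemma packing_premeasure_ge0 F : 0 <= packing_premeasure s F.
Proof.
apply: le_ereal_inf_tmp => _ [u _ <-]; apply: ereal_sup_ubound.
exists set0, (fun=> 0%R), (fun=> 0%R); rewrite esum_set0; split=> //.
Qed.

(** In a labelled cover, testing the infimum over scales of [packing_premeasure] at the label [r j]
    bounds it on [E j] by [Phi]. *)
Lemma packing_measure_le_content A :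
  packing_measure s A <= labelled_content s A.
Proof.
apply: le_ereal_inf_tmp => _ [E [r [[AE rE] ->]]].
have r0 j : (0 < r j)%R by have [] := rE j.
apply: (@le_trans _ _ (\sum_(0 <= j <oo) packing_premeasure s (E j))).
  by apply: ereal_inf_lbound; exists E.
apply: lee_nneseries => [j _ _|j _].
  exact: packing_premeasure_ge0.
apply: le_trans (packing_le_Phi s _ (r0 j)).
by apply: ereal_inf_lbound; exists (r j)%:E; rewrite /= ?lte_fin.
Qed.

Lemma le_packing_premeasure_at (u v : \bar R) F : u <= v ->
  packing_premeasure_at s u F <= packing_premeasure_at s v F.
Proof.
move=> uv; apply: ereal_sup_le => _ [I [x [r [tI Ixr ->]]]].
exists I, x, r; split=> // i /Ixr[? ? ru]; split=> //; exact: le_trans ru uv.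
Qed.

End LabelledMeasure.

(** * The last inequality *)

Section UpperBound.
Context {R : realType} {d : nat} (s : R).
Context (s_gt0 : (0 < s)%R).
Let K : R := (2 `^ s * (2 * 6 `^ s))%R.

Let K_gt0 : (0 < K)%R. Proof. by rewrite !mulr_gt0 ?powR_gt0. Qed.

(** A packing scale [u] above [delta] is lowered to [delta]; below [delta], the labels are
    restricted to [u] instead. Both changes are monotone in the right direction. *)
Lemma labelled_le_packing_premeasure delta (F : set 'rV[R]_d) : (0 < delta)%R ->
  labelled_premeasure s delta F <= K%:E * packing_premeasure s F.
Proof.
move=> d0; rewrite -lee_pdivrMl//; apply: le_ereal_inf_tmp => _ [u /= u0 <-].
rewrite lee_pdivrMl//.
have bound v : (0 < v)%R ->
    labelled_premeasure s v F <= K%:E * packing_premeasure_at s v%:E F.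
  move=> v0; apply: le_trans (labelled_le_finite_premeasure s_gt0 F v0) _.
  by rewrite lee_pmul2l// finite_premeasure_le_packing.
have [du|ud] := leP delta%:E u.
  apply: le_trans (bound _ d0) _.
  by rewrite lee_pmul2l// le_packing_premeasure_at.
case: u u0 ud => [v| |]//; rewrite !lte_fin => v0 /ltW vd.
exact: le_trans (le_labelled_premeasure s F vd) (bound _ v0).
Qed.

(** At a fixed label bound [u], subadditivity over a cover of [A] reduces the claim to the
    premeasures of its members. *)
Lemma labelled_le_packing_measure (A : set 'rV[R]_d) :
  labelled_measure s A <= K%:E * packing_measure s A.
Proof.
rewrite labelled_measureE; apply: ge_ereal_sup => _ [u /= /andP[u0 _] <-].
rewrite -lee_pdivrMl//; apply: le_ereal_inf_tmp => _ [E [AE ->]].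
rewrite lee_pdivrMl//.
apply: le_trans (labelled_premeasure_sigma_subadditive s u AE) _.
rewrite -nneseriesZl//; last by move=> j _; exact: packing_premeasure_ge0.
apply: lee_nneseries => [j _ _|j _]; first exact: labelled_premeasure_ge0.
exact: labelled_le_packing_premeasure.
Qed.

End UpperBound.

Theorem corollary1p2 (R : realType) (s : R) (hs : (0 < s)%R) :
  exists C : R, (0 < C)%R /\
    forall (d : nat) (hd : (1 <= d)%N) (A : set 'rV[R]_d)
           (delta : R) (hdelta : (0 < delta)%R),
      [/\ packing_measure s A <= labelled_content s A,
          labelled_content s A <= labelled_premeasure s delta A,
          labelled_premeasure s delta A <= labelled_measure s A
        & labelled_measure s A <= C%:E * packing_measure s A].
Proof.
exists (2 `^ s * (2 * 6 `^ s))%R; split; first by rewrite !mulr_gt0 ?powR_gt0.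
move=> d _ A delta d0; split.
- exact: packing_measure_le_content.
- exact: labelled_content_le.
- exact: labelled_premeasure_le_measure.
- exact: labelled_le_packing_measure.
Qed.
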